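(* Let $n$ and $m$ be positive integers such that $n$ is a factor of $2m$ and $\frac{2m}{n}+1$ is a factor of $n$. Then there exists a circulant graph $G_c^m$ having $n$ vertices and $m$ edges with the following properties. (i) $G_c^m$ is a Largest Eigenvalue Global Minimizer (LEGM). (ii) The first row of the (circulant) adjacency matrix of $G_c^m$ is a solution of the DFT magnitude minimization problem with parameters $n$ and $d=\frac{2m}{n}$. (iii) The complement $G_c^c$ of $G_c^m$ is also a circulant graph and has the highest algebraic connectivity, i.e. $G_c^c$ is an Algebraic Connectivity Maximizer (ACM).
   Context: All graphs are simple, undirected and unweighted (no self loops, no multiple edges). The Laplacian of $G$ is $L(G)=D(G)-A(G)$, where $D(G)$ is the diagonal matrix of vertex degrees and $A(G)$ is the adjacency matrix; $\lambda_1(G)\geqslant\cdots\geqslant\lambda_{n-1}(G)\geqslant\lambda_n(G)=0$ are its eigenvalues. The algebraic connectivity of $G$ is $\lambda_{n-1}(G)$, the second smallest Laplacian eigenvalue. A matrix $C\in\mathbb{R}^{n\times n}$ is circulant if $c_{i,j}=c_{i+k,j+k}$ for all $i,j,k$, indices taken modulo $n$. A circulant graph is one whose Laplacian is a circulant matrix after a re-ordering of the vertices, if needed; its adjacency matrix is taken with respect to such an ordering. The complement of a graph has the same vertex set, and two distinct vertices are adjacent in it iff they are not adjacent in the original graph. A graph $G$ with $n$ vertices and $m$ edges is an LEGM if $\lambda_1(G)\leqslant\lambda_1(H)$ for every simple graph $H$ with $n$ vertices and $m$ edges. A graph with $n$ vertices and $m'$ edges is an ACM if its algebraic connectivity is the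 largest among all simple graphs with $n$ vertices and $m'$ edges. DFT magnitude minimization problem: given positive integers $d,n$ with $1\leqslant d\leqslant n-1$, consider vectors $x\in\{0,1\}^n$ with $x_1=0$, $\|x\|_1=d$, and $x$ time-symmetric, i.e. $x_i=x_{n+2-i}$ for $i=2,\dots,n$. For such $x$ define $\bar x\in\mathbb{R}^n$ by $\bar x_1=-d$ and $\bar x_i=x_i$ for $i\neq 1$, and let $X=\mathrm{DFT}(\bar x)$, i.e. $X_k=\sum_{j=1}^n\bar x_j e^{-2\pi \mathrm{i}(j-1)(k-1)/n}$ for $k=1,\dots,n$ (which is real by the time-symmetry). The problem is to find $x$ satisfying these conditions such that $\|X\|_\infty$ is minimized. *)

(* Defs.v *)
From HB Require Import structures.
From mathcomp Require Import all_boot all_order all_algebra.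
From mathcomp Require Import perm complex spectral.
From mathcomp Require Import boolp classical_sets reals trigo.

Set Implicit Arguments.
Unset Strict Implicit.
Unset Printing Implicit Defensive.

Import Order.TTheory GRing.Theory Num.Theory.
Local Open Scope ring_scope.
Local Open Scope classical_set_scope.
Local Open Scope complex_scope.

Record sgraph (n : nat) := SGraph {
  adj : rel 'I_n;
  adj_sym : symmetric adj;
  adj_irr : irreflexive adj }.

Section Graphs.
Variable n : nat.
Implicit Types G : sgraph n.

(* Each edge is counted once, as the pair of its endpoints in increasing
   order. *)
Definition nb_edges G : nat :=
  #|[set p : 'I_n * 'I_n | (p.1 < p.2)%N && adj G p.1 p.2]%SET|.

Definition degree G (i : 'I_n) : nat := #|[set j | adj G i j]%SET|.

Definition compl_adj G : rel 'I_n := fun i j => (i != j) && ~~ adj G i j.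

Lemma compl_adj_sym G : symmetric (compl_adj G).
Proof. by move=> i j; rewrite /compl_adj eq_sym adj_sym. Qed.

Lemma compl_adj_irr G : irreflexive (compl_adj G).
Proof. by move=> i; rewrite /compl_adj eqxx. Qed.

Definition compl G : sgraph n := SGraph (@compl_adj_sym G) (@compl_adj_irr G).

Definition relabel_adj (s : 'S_n) G : rel 'I_n := fun i j => adj G (s i) (s j).

Lemma relabel_adj_sym s G : symmetric (relabel_adj s G).
Proof. by move=> i j; rewrite /relabel_adj adj_sym. Qed.

Lemma relabel_adj_irr s G : irreflexive (relabel_adj s G).
Proof. by move=> i; rewrite /relabel_adj adj_irr. Qed.

Definition relabel s G : sgraph n :=
  SGraph (@relabel_adj_sym s G) (@relabel_adj_irr s G).

End Graphs.

Section Spectra.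
Variables (R : realType) (n : nat).
Implicit Types (G : sgraph n) (M : 'M[R]_n).

Definition adjmx G : 'M[R]_n := \matrix_(i, j) (adj G i j)%:R.

Definition degmx G : 'M[R]_n := diag_mx (\row_i (degree G i)%:R).

Definition laplacian G : 'M[R]_n := degmx G - adjmx G.

(* The eigenvalues of M in nonincreasing order, repeated according to their
   algebraic multiplicity.  The default value [::] only occurs when the
   characteristic polynomial of M does not split over R, which is excluded for
   Laplacians by laplacian_eigenvaluesP below. *)
Definition eigenvalues M : seq R :=
  xget [::] [set s : seq R | sorted >=%R s /\
                             char_poly M = \prod_(a <- s) ('X - a%:P)].

(* Numbered from 1, so that lambda 1 G is the largest eigenvalue. *)
Definition lambda (k : nat) G : R := nth 0 (eigenvalues (laplacian G)) k.-1.

Definition algebraic_connectivity G : R := lambda n.-1 G.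

Lemma char_poly_sym_split M : M^T = M ->
  exists s : seq R, char_poly M = \prod_(a <- s) ('X - a%:P).
Proof.
move=> Msym; pose A := map_mx (real_complex R) M.
have Ah : A \is hermsymmx.
  apply/is_hermitianmxP; rewrite expr0 scale1r; apply/matrixP => i j.
  by rewrite !mxE -{1}Msym mxE conj_Creal // complex_real.
have /hermitian_normalmx/orthomx_spectralP A_eq := Ah.
have dE j : (complex.Re (spectral_diag A 0 j : R[i]))%:C = spectral_diag A 0 j.
  by apply: RRe_real; have /mxOverP := hermitian_spectral_diag_real Ah; apply.
exists [seq complex.Re (spectral_diag A 0 j : R[i]) | j <- enum 'I_n].
apply: (map_poly_inj (real_complex R)).
rewrite big_map map_char_poly -/A rmorph_prod big_enum /=.
under [RHS]eq_bigr do rewrite map_polyXsubC /= dE.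
set D := diag_mx (spectral_diag A); set P := spectralmx A in A_eq.
have Pu : P \in unitmx := spectral_unit A.
have -> : char_poly A = char_poly D.
  rewrite /char_poly.
  have -> : char_poly_mx A = map_mx polyC (invmx P) *m char_poly_mx D *m map_mx polyC P.
    rewrite /char_poly_mx mulmxBr mulmxBl -!map_mxM -[in RHS]A_eq; congr (_ - _).
    by rewrite scalar_mxC -mulmxA -map_mxM mulVmx // map_mx1 mulmx1.
  by rewrite !det_mulmx mulrAC -det_mulmx -map_mxM mulVmx // map_mx1 det1 mul1r.
rewrite char_poly_trig ?diag_mx_is_trig //.
by apply: eq_bigr => i _; rewrite mxE eqxx.
Qed.

Lemma laplacian_sym G : (laplacian G)^T = laplacian G.
Proof.
by rewrite linearB /= tr_diag_mx; congr (_ - _); apply/matrixP => i j; rewrite !mxE adj_sym.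
Qed.

Lemma laplacian_eigenvaluesP G :
  sorted >=%R (eigenvalues (laplacian G)) /\
  char_poly (laplacian G) =
    \prod_(a <- eigenvalues (laplacian G)) ('X - a%:P).
Proof.
have [s sE] := char_poly_sym_split (laplacian_sym G).
apply: (@xgetPex _ [::] [set s : seq R | sorted >=%R s /\
  char_poly (laplacian G) = \prod_(a <- s) ('X - a%:P)]).
exists (sort >=%R s); split; first by apply: sort_sorted => x y; exact: le_total.
by rewrite sE; apply: perm_big; rewrite perm_sym perm_sort.
Qed.

Lemma size_laplacian_eigenvalues G : size (eigenvalues (laplacian G)) = n.
Proof.
have [_ cE] := laplacian_eigenvaluesP G; have := size_char_poly (laplacian G).
by rewrite cE size_prod_XsubC => -[].
Qed.

(* C i j = C (i + k) (j + k), with the indices taken modulo n. *)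
Definition circulant_mx (T : Type) (C : 'M[T]_n) : Prop :=
  forall (i j i' j' : 'I_n) (k : nat),
    i' = i + k %[mod n] -> j' = j + k %[mod n] -> C i j = C i' j'.

Definition circulant_ordering G (s : 'S_n) : Prop :=
  circulant_mx (laplacian (relabel s G)).

Definition circulant_graph G : Prop := exists s : 'S_n, circulant_ordering G s.

Definition LEGM G : Prop :=
  forall H : sgraph n, nb_edges H = nb_edges G -> lambda 1 G <= lambda 1 H.

Definition ACM G : Prop :=
  forall H : sgraph n, nb_edges H = nb_edges G ->
    algebraic_connectivity H <= algebraic_connectivity G.

End Spectra.

(* Vectors are indexed from 0: the index k of 'I_n stands for the entry k + 1
   of a vector (x_1, ..., x_n). *)
Section DFT.
Variables (R : realType) (n : nat).

(* exp(i t) *)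
Definition expi (t : R) : R[i] := cos t +i* sin t.

Definition dft (x : 'rV[R]_n) : 'rV[R[i]]_n :=
  \row_(k < n) \sum_(j < n)
    (x 0 j)%:C * expi (- (2 * pi * j%:R * k%:R / n%:R)).

Definition norm1 (x : 'rV[R]_n) : R := \sum_(j < n) `|x 0 j|.

Definition norm_infty (X : 'rV[R[i]]_n) : R :=
  \big[Num.max/0]_(k < n) ComplexField.Normc.normc (X 0 k).

Definition dft_feasible (d : nat) (x : 'rV[R]_n) : Prop :=
  [/\ forall j : 'I_n, x 0 j = 0 \/ x 0 j = 1,
      forall j : 'I_n, j = 0%N :> nat -> x 0 j = 0,
      norm1 x = d%:R &
      forall i j : 'I_n, (i + j = n)%N -> x 0 i = x 0 j].

Definition xbar (d : nat) (x : 'rV[R]_n) : 'rV[R]_n :=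
  \row_(j < n) (if j == 0%N :> nat then - d%:R else x 0 j).

Definition dft_solution (d : nat) (x : 'rV[R]_n) : Prop :=
  dft_feasible d x /\
  forall y : 'rV[R]_n, dft_feasible d y ->
    norm_infty (dft (xbar d x)) <= norm_infty (dft (xbar d y)).

End DFT.

(* Main.v *)
(* With d = 2m/n, take the disjoint union of n/(d+1) cliques of size d+1,
   joining distinct vertices that are congruent mod n/(d+1).  Its Laplacian
   satisfies L^2 = (d+1) L, so its eigenvalues are 0 and d+1.  For any graph
   with n vertices and m edges, tr L = nd and
   tr L^2 = sum_i (d_i^2 + d_i) >= nd(d+1), while tr L^2 <= lambda_1 tr L
   because the eigenvalues are nonnegative; hence lambda_1 >= d+1.  The same
   argument, with Parseval's identity in place of the traces, bounds the DFT
   norm below.  The algebraic connectivity of the complement is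
   n - lambda_1. *)
Require Import Defs.
From mathcomp Require Import all_boot all_order all_algebra.
From mathcomp Require Import perm reals.
From mathcomp Require Import complex trigo ring lra.

Set Implicit Arguments.
Unset Strict Implicit.
Unset Printing Implicit Defensive.

Import Order.TTheory GRing.Theory Num.Theory.
Local Open Scope complex_scope.
Local Open Scope ring_scope.

(** * Split characteristic polynomials and the traces of a matrix and its square *)

Section CharPoly.
Variables (F : comNzRingType) (n : nat).
Implicit Types (A : 'M[F]_n) (s : seq F) (q : {poly F}).

(** Composition with [q] is a ring morphism, so it commutes with the determinant. *)
Lemma det_scalar_sub A q :
  \det (q%:M - map_mx polyC A) = char_poly A \Po q.
Proof.
rewrite /char_poly -det_map_mx; congr (\det _); apply/matrixP => i j.
by rewrite !mxE rmorphB rmorphMn /= comp_polyX comp_polyC.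
Qed.

Lemma det_scalar_sub_split A s q :
  char_poly A = \prod_(a <- s) ('X - a%:P) ->
  \det (q%:M - map_mx polyC A) = \prod_(a <- s) (q - a%:P).
Proof.
rewrite det_scalar_sub => ->; rewrite rmorph_prod; apply: eq_bigr => a _.
by rewrite rmorphB /= comp_polyX comp_polyC.
Qed.

Lemma size_char_poly_split A s :
  char_poly A = \prod_(a <- s) ('X - a%:P) -> size s = n.
Proof.
move=> sE; have := size_char_poly A.
by rewrite sE size_prod_XsubC => -[].
Qed.

Lemma det_scalar_add_split A s q :
  char_poly A = \prod_(a <- s) ('X - a%:P) ->
  \det (q%:M + map_mx polyC A) = \prod_(a <- s) (q + a%:P).
Proof.
move=> sE.
have -> : q%:M + map_mx polyC A = (-1) *: ((- q)%:M - map_mx polyC A).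
  by rewrite scaleN1r rmorphN /= opprB opprK addrC.
rewrite detZ (det_scalar_sub_split _ sE) -{1}(size_char_poly_split sE).
have -> : (-1 : {poly F}) ^+ size s = \prod_(a <- s) -1.
  by rewrite big_const_seq count_predT iter_mulr_1.
rewrite -big_split /=.
by apply: eq_bigr => a _; rewrite mulN1r opprB opprK addrC.
Qed.

(** X^2 - A^2 = (X - A)(X + A), so the determinant at X^2 is the product of the X^2 - a^2. *)
Lemma char_poly_sqr_split A s :
  char_poly A = \prod_(a <- s) ('X - a%:P) ->
  char_poly (A *m A) = \prod_(a <- [seq a ^+ 2 | a <- s]) ('X - a%:P).
Proof.
move=> sE; set p := RHS.
(* Substituting X^2 loses nothing: coefficient i reappears as coefficient 2i. *)
suff E : char_poly (A *m A) \Po 'X^2 = p \Po 'X^2.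
  apply/polyP => i; have /(congr1 (fun r : {poly F} => r`_(2 * i))) := E.
  by rewrite !coef_comp_poly_Xn // dvdn_mulr // mulKn.
rewrite -det_scalar_sub map_mxM /=.
have -> : ('X^2)%:M - map_mx polyC A *m map_mx polyC A =
    ('X%:M - map_mx polyC A) *m ('X%:M + map_mx polyC A).
  rewrite mulmxDr !mulmxBl -scalar_mxM -expr2 addrA scalar_mxC.
  by rewrite subrK.
rewrite det_mulmx (det_scalar_sub_split _ sE) (det_scalar_add_split _ sE).
rewrite -big_split /= /p big_map rmorph_prod; apply: eq_bigr => a _.
by rewrite rmorphB /= comp_polyX comp_polyC -subr_sqr rmorphXn.
Qed.

(** Both sides are, up to sign, the coefficient of X^(n-1); for n = 0 both are empty sums. *)
Lemma trace_split A s :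
  char_poly A = \prod_(a <- s) ('X - a%:P) -> \tr A = \sum_(a <- s) a.
Proof.
move=> sE; have sz := size_char_poly_split sE.
have [n0|n_gt0] := posnP n.
  have -> : s = [::] by apply/size0nil; rewrite sz.
  rewrite big_nil /mxtrace big1 // => i _.
  by have := ltn_ord i; rewrite {2}n0.
apply: oppr_inj; rewrite -char_poly_trace // sE -[in LHS]sz.
by rewrite coefPn_prod_XsubC // sz -lt0n.
Qed.

Lemma trace_sqr_split A s :
  char_poly A = \prod_(a <- s) ('X - a%:P) ->
  \tr (A *m A) = \sum_(a <- s) a ^+ 2.
Proof. by move=> /char_poly_sqr_split/trace_split; rewrite big_map. Qed.

End CharPoly.

(* Both sides are the determinant of [block_mx y%:M u (- v) 1], up to the factor
   y, computed by clearing either off-diagonal block. *)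
Lemma det_scalar_add_rank1 (K : comNzRingType) n (y : K) (u : 'cV[K]_n)
    (v : 'rV[K]_n) :
  y * \det (y%:M + u *m v) = y ^+ n * (y + (v *m u) 0 0).
Proof.
pose B := block_mx y%:M u (- v) (1%:M : 'M_1).
have E1 : B *m block_mx 1%:M 0 v 1%:M = block_mx (y%:M + u *m v) u 0 1%:M.
  by rewrite mulmx_block !mulmx1 !mulmx0 !mul1mx !add0r addNr.
have E2 : B *m block_mx 1%:M (- u) 0 y%:M =
    block_mx y%:M 0 (- v) (v *m u + y%:M).
  rewrite mulmx_block !mulmx1 !mulmx0 !mul1mx !addr0 mulmxN mulNmx mulmxN opprK.
  by rewrite scalar_mxC addNr.
have /(congr1 determinant) := E1; have /(congr1 determinant) := E2.
rewrite !det_mulmx det_ublock !det_lblock !det_ublock !det1 !mul1r !mulr1.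
rewrite !det_scalar expr1 det_mx11 !mxE eqxx mulr1n => E2' E1'.
by rewrite -E1' mulrC E2' addrC.
Qed.

(** Mirror image of [path_sortedE]; it isolates the smallest eigenvalue at the end of a
    nonincreasing list. *)
Lemma sorted_rcons_trans (T : Type) (e : rel T) (x : T) (s : seq T) :
  transitive e -> sorted e (rcons s x) = all (e^~ x) s && sorted e s.
Proof.
move=> etr; rewrite -[rcons s x]revK rev_sorted rev_rcons /= path_sortedE.
  by rewrite all_rev rev_sorted.
by move=> b a c ba cb; exact: etr cb ba.
Qed.

(** * Laplacian spectra, the bound on the largest eigenvalue, and complements *)

Section Laplacian.
Variables (R : realType) (n : nat).
Implicit Types G H : sgraph n.

Lemma laplacianE G i j :
  laplacian R G i j = (degree G i)%:R *+ (i == j) - (adj G i j)%:R.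
Proof. by rewrite !mxE. Qed.

Lemma natr_degree G i : (degree G i)%:R = \sum_j (adj G i j)%:R :> R.
Proof.
rewrite /degree -sum1_card natr_sum [LHS]big_mkcond /=.
by apply: eq_bigr => j _; rewrite inE; case: (adj G i j).
Qed.

Lemma handshake G : (\sum_i degree G i = 2 * nb_edges G)%N.
Proof.
have degE i : degree G i = (\sum_j adj G i j)%N.
  rewrite /degree -sum1_card big_mkcond /=.
  by apply: eq_bigr => j _; rewrite inE; case: (adj G i j).
under eq_bigr do rewrite degE.
have nbE : nb_edges G = (\sum_(i < n) \sum_(j < n) ((i < j) && adj G i j)%N)%N.
  rewrite /nb_edges -sum1_card pair_big big_mkcond /=.
  by apply: eq_bigr => -[i j] _; rewrite inE /=; case: (_ && _).
have nbE' : nb_edges G = (\sum_(i < n) \sum_(j < n) ((j < i) && adj G i j)%N)%N.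
  rewrite nbE exchange_big /=; apply: eq_bigr => i _; apply: eq_bigr => j _.
  by rewrite adj_sym.
rewrite mul2n -addnn {1}nbE nbE' -big_split /=; apply: eq_bigr => i _.
rewrite -big_split /=; apply: eq_bigr => j _.
case: ltngtP => [//|_|/val_inj ->] /=; rewrite ?addn0 ?adj_irr //.
Qed.

Lemma trace_laplacian G : \tr (laplacian R G) = (2 * nb_edges G)%:R.
Proof.
rewrite -handshake natr_sum; apply: eq_bigr => i _.
by rewrite laplacianE eqxx adj_irr subr0.
Qed.

(** Entry (i, i) of L^2 is the squared norm of row i: the squared degree, plus one for each
    neighbour. *)
Lemma trace_laplacian_sqr G :
  \tr (laplacian R G *m laplacian R G) =
    \sum_i (degree G i)%:R ^+ 2 + (2 * nb_edges G)%:R.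
Proof.
rewrite -handshake natr_sum -big_split; apply: eq_bigr => i _ /=.
rewrite mxE [X in _ + X]natr_degree.
rewrite (bigD1 i) //= [in RHS](bigD1 i) //= !laplacianE eqxx adj_irr subr0 add0r.
rewrite mulr1n expr2; congr (_ + _); apply: eq_bigr => j ji.
rewrite !laplacianE eq_sym (negbTE ji) !mulr0n !add0r adj_sym mulrNN.
by case: (adj _ _ _); rewrite ?mulr1 ?mulr0.
Qed.

(** The quadratic form of L at an eigenvector v is a |v|^2, and also half the sum of (v_i - v_j)^2
    over ordered pairs of adjacent vertices. *)
Lemma laplacian_eigenvalue_ge0 G (a : R) :
  eigenvalue (laplacian R G) a -> 0 <= a.
Proof.
move=> /eigenvalueP[v vL v0].
have vv_gt0 : 0 < \sum_j v 0 j ^+ 2.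
  have [j vj] := rV0Pn _ v0.
  rewrite (bigD1 j) //= ltr_pwDl //; first by rewrite exprn_even_gt0.
  by apply: sumr_ge0 => k _; exact: sqr_ge0.
rewrite -(pmulr_lge0 _ vv_gt0).
have -> : a * (\sum_j v 0 j ^+ 2) =
    2^-1 * \sum_i \sum_j (adj G i j)%:R * (v 0 i - v 0 j) ^+ 2.
  have -> : a * (\sum_j v 0 j ^+ 2) = \sum_j (v *m laplacian R G) 0 j * v 0 j.
    by rewrite vL mulr_sumr; apply: eq_bigr => j _; rewrite mxE expr2 mulrA.
  have -> : \sum_j (v *m laplacian R G) 0 j * v 0 j =
      \sum_i \sum_j (adj G i j)%:R * (v 0 i ^+ 2 - v 0 i * v 0 j).
    under eq_bigr do rewrite mxE mulr_suml.
    rewrite exchange_big /=; apply: eq_bigr => i _.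
    under [RHS]eq_bigr do rewrite mulrBr.
    rewrite big_split /= sumrN -mulr_suml -natr_degree.
    under eq_bigr do rewrite laplacianE mulrBr mulrBl.
    rewrite big_split /= sumrN; congr (_ - _); last first.
      by apply: eq_bigr => j _; ring.
    rewrite (bigD1 i) //= eqxx mulr1n big1 ?addr0; first by ring.
    by move=> j ji; rewrite eq_sym (negbTE ji) mulr0n mulr0 mul0r.
  (* Averaging S with its copy under the exchange of i and j turns v_i^2 - v_i v_j into half of (v_i
     - v_j)^2. *)
  set S := LHS.
  have S' : S = \sum_i \sum_j (adj G i j)%:R * (v 0 j ^+ 2 - v 0 i * v 0 j).
    rewrite /S exchange_big; apply: eq_bigr => i _; apply: eq_bigr => j _.
    by rewrite adj_sym [v 0 i * _]mulrC.
  have -> : S = 2^-1 * (S + S) by field.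
  rewrite {2}S' /S -big_split; congr (_ * _); apply: eq_bigr => i _.
  by rewrite -big_split; apply: eq_bigr => j _ /=; ring.
rewrite mulr_ge0 ?invr_ge0 ?ler0n //; apply: sumr_ge0 => i _.
by apply: sumr_ge0 => j _; rewrite mulr_ge0 ?ler0n ?sqr_ge0.
Qed.

Lemma mem_eigenvalues_laplacian G (a : R) :
  (a \in eigenvalues (laplacian R G)) = eigenvalue (laplacian R G) a.
Proof.
have [_ sE] := laplacian_eigenvaluesP R G.
by rewrite eigenvalue_root_char sE root_prod_XsubC.
Qed.

Lemma eigenvalue_le_lambda1 G (a : R) :
  eigenvalue (laplacian R G) a -> a <= lambda R 1 G.
Proof.
rewrite -mem_eigenvalues_laplacian /lambda /=.
have [+ _] := laplacian_eigenvaluesP R G.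
case: (eigenvalues _) => //= b s; rewrite path_sortedE; last first.
  by move=> x y z xy yz; exact: le_trans yz xy.
by case/andP=> /allP sb _; rewrite inE => /predU1P[-> //|/sb].
Qed.

Lemma eigenvalue_lambda1 G : (0 < n)%N ->
  eigenvalue (laplacian R G) (lambda R 1 G).
Proof.
by move=> n0; rewrite -mem_eigenvalues_laplacian mem_nth //
  size_laplacian_eigenvalues.
Qed.

Lemma lambda1_ge G (d : nat) : (0 < n)%N -> (0 < d)%N ->
  (n * d = 2 * nb_edges G)%N -> d%:R + 1 <= lambda R 1 G.
Proof.
move=> n0 d0 nd; have [_ sE] := laplacian_eigenvaluesP R G.
have trL := trace_split sE; have trL2 := trace_sqr_split sE.
rewrite trace_laplacian -nd in trL; rewrite trace_laplacian_sqr -nd in trL2.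
have ub : \sum_(a <- eigenvalues (laplacian R G)) a ^+ 2
    <= lambda R 1 G * (n * d)%:R.
  rewrite trL mulr_sumr big_seq [leRHS]big_seq.
  apply: ler_sum => a; rewrite mem_eigenvalues_laplacian => aL.
  by rewrite expr2 ler_wpM2r ?(laplacian_eigenvalue_ge0 aL) //
    eigenvalue_le_lambda1.
have lb : (n * d)%:R * d%:R <= \sum_i (degree G i)%:R ^+ 2 :> R.
  rewrite -subr_ge0.
  (* The mean degree is d, so this difference is n times the variance of the degrees. *)
  have -> : \sum_i (degree G i)%:R ^+ 2 - (n * d)%:R * d%:R =
      \sum_i ((degree G i)%:R - d%:R) ^+ 2 :> R.
    under [RHS]eq_bigr do rewrite sqrrB -addrA.
    rewrite big_split /=; congr (_ + _).
    rewrite big_split /= sumr_const card_ord sumrN sumrMnl -mulr_suml -natr_sum.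
    rewrite handshake -nd !natrM -mulr_natl; ring.
  by apply: sumr_ge0 => i _; exact: sqr_ge0.
have nd0 : 0 < (n * d)%:R :> R by rewrite ltr0n muln_gt0 n0.
rewrite -(ler_pM2l nd0) mulrDr mulr1 [leRHS]mulrC (le_trans _ ub) //.
by rewrite -trL2 lerD2r.
Qed.

Lemma compl_adjmx G :
  adjmx R (compl G) = const_mx 1 - 1%:M - adjmx R G.
Proof.
apply/matrixP => i j; rewrite !mxE /= /compl_adj.
have [->|ij] := eqVneq i j; first by rewrite adj_irr subrr subr0.
by case: (adj G i j) => /=; rewrite ?subr0 ?subrr.
Qed.

Lemma degree_compl G i : (degree G i + degree (compl G) i = n.-1)%N.
Proof.
rewrite /degree -cardsUI -[in RHS](card_ord n) -(cardsC1 i).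
have -> : [set j | adj G i j] :&: [set j | adj (compl G) i j] = set0.
  by apply/setP => j; rewrite !inE /= /compl_adj andbCA andbN andbF.
rewrite cards0 addn0; apply: eq_card => j; rewrite !inE /= /compl_adj eq_sym.
by have [<-|] := eqVneq i j; rewrite ?adj_irr // orbN.
Qed.

Lemma laplacian_compl G :
  laplacian R (compl G) = n%:R%:M - const_mx 1 - laplacian R G.
Proof.
apply/matrixP => i j.
have degC : (degree (compl G) i)%:R = n%:R - 1 - (degree G i)%:R :> R.
  have n0 : (0 < n)%N by apply: leq_trans (ltn_ord i).
  have -> : n%:R = n.-1%:R + 1 :> R by rewrite natr1 prednK.
  by rewrite addrK -(degree_compl G i) natrD addrAC subrr add0r.
rewrite laplacianE degC.
have := congr1 (fun M : 'M[R]_n => M i j) (compl_adjmx G); rewrite !mxE => ->.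
by case: (i == j); rewrite ?mulr1n ?mulr0n; ring.
Qed.

Lemma laplacian_mulJ G : laplacian R G *m (const_mx 1 : 'cV_n) = 0.
Proof.
apply/matrixP => i j; rewrite mxE [RHS]mxE.
under eq_bigr do rewrite laplacianE mxE mulr1.
rewrite big_split /= sumrN -natr_degree (bigD1 i) //= eqxx big1 ?addr0 ?subrr //.
by move=> k /negbTE; rewrite eq_sym => ->.
Qed.

(* Writing L' = n - J - L for the Laplacian of the complement and y = X - n,
   y * (X - L') = (y + L) * (y + J) since L J = 0. *)
Lemma char_poly_compl G (s : seq R) :
  char_poly (laplacian R G) = \prod_(a <- s) ('X - a%:P) ->
  ('X - n%:R%:P) * char_poly (laplacian R (compl G)) =
  'X * \prod_(a <- s) ('X - (n%:R - a)%:P).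
Proof.
move=> sE; pose y : {poly R} := 'X - n%:R%:P.
have y0 : y != 0 by rewrite polyXsubC_eq0.
pose u : 'cV[{poly R}]_n := const_mx 1; pose v : 'rV[{poly R}]_n := const_mx 1.
have LE : y *: char_poly_mx (laplacian R (compl G)) =
    (y%:M + map_mx polyC (laplacian R G)) *m (y%:M + u *m v).
  rewrite mulmxDr mul_mx_scalar [X in _ + X]mulmxDl (mulmxA (map_mx _ _)).
  have -> : map_mx polyC (laplacian R G) *m u = 0.
    have -> : u = map_mx polyC (const_mx 1) by rewrite map_const_mx.
    by rewrite -map_mxM laplacian_mulJ map_mx0.
  rewrite mul0mx addr0 mul_scalar_mx -scalerDr; congr (_ *: _).
  rewrite /char_poly_mx laplacian_compl; apply/matrixP => i j.
  rewrite !mxE big_ord1 !mxE !rmorphB /= rmorphMn /=.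
  by case: (i == j); rewrite /y ?mulr1n ?mulr0n; ring.
(* The extra factor y is the one in [det_scalar_add_rank1]; then y^n cancels, and y + v u = y + n =
   X. *)
have := congr1 (fun M => y * \det M) LE.
rewrite detZ det_mulmx (det_scalar_add_split _ sE) [RHS]mulrCA.
rewrite det_scalar_add_rank1 [RHS]mulrCA [LHS]mulrCA.
move=> /mulfI -> //; last by rewrite expf_neq0.
rewrite mulrC; congr (_ * _).
  rewrite mxE; under eq_bigr do rewrite !mxE mulr1.
  by rewrite sumr_const card_ord /y -polyC_natr subrK.
by apply: eq_bigr => a _; rewrite /y rmorphB /=; ring.
Qed.

(** The eigenvalues of the complement are the n - a for a an eigenvalue of G, except that one zero
    of G yields 0 instead of n. *)
Lemma algebraic_connectivity_compl G : (1 < n)%N ->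
  algebraic_connectivity R (compl G) = n%:R - lambda R 1 G.
Proof.
move=> n1; have n0 : (0 < n)%N by exact: ltnW.
rewrite /algebraic_connectivity /lambda.
have [] := laplacian_eigenvaluesP R G.
have [] := laplacian_eigenvaluesP R (compl G).
have := size_laplacian_eigenvalues R G.
have : all (>= 0) (eigenvalues (laplacian R (compl G))).
  by apply/allP => a; rewrite mem_eigenvalues_laplacian;
    exact: laplacian_eigenvalue_ge0.
have : all (>= 0) (eigenvalues (laplacian R G)).
  by apply/allP => a; rewrite mem_eigenvalues_laplacian;
    exact: laplacian_eigenvalue_ge0.
move: (eigenvalues (laplacian R G)) (eigenvalues (laplacian R (compl G))).
move=> s s' s_ge0 s'_ge0 sz s'_sorted s'E s_sorted sE.
have ge_trans : transitive (>=%R : rel R) by move=> y x z xy /le_trans; exact.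
have /prod_XsubC_eq perm_s' :
    \prod_(a <- n%:R :: s') ('X - a%:P) =
    \prod_(a <- 0 :: [seq n%:R - a | a <- s]) ('X - a%:P).
  by rewrite !big_cons big_map subr0 -(char_poly_compl sE) s'E.
(* n occurs on the right and is not the leading 0, so 0 is an eigenvalue of G; in a nonincreasing
   list of nonnegative numbers it can be taken last. *)
have [s0 s_rcons] : exists s0, s = rcons s0 0.
  have : n%:R \in 0 :: [seq n%:R - a | a <- s].
    by rewrite -(perm_mem perm_s') mem_head.
  rewrite inE pnatr_eq0 -[n == 0]negbK -lt0n n0 /= => /mapP[a + /eqP].
  rewrite eq_sym subr_eq addrC -subr_eq subrr eq_sym => + /eqP a0; rewrite {a}a0.
  case/lastP: s s_ge0 s_sorted {sz sE perm_s'} => // s0 b; rewrite all_rcons.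
  move=> /andP[b0 _]; rewrite sorted_rcons_trans // => /andP[/allP bs0 _] s00.
  exists s0; congr rcons; apply: le_anti; rewrite b0 andbT.
  by move: s00; rewrite mem_rcons inE => /predU1P[<-|/bs0].
have {}perm_s' : perm_eq s' (rcons (rev [seq n%:R - a | a <- s0]) 0).
  rewrite perm_sym perm_rcons perm_sym -(perm_cons n%:R) (perm_trans perm_s') //.
  rewrite s_rcons map_rcons subr0 -rcons_cons perm_rcons !perm_cons.
  by rewrite perm_sym perm_rev.
have sz0 : size s0 = n.-1 by rewrite -sz s_rcons size_rcons.
(* Two nonincreasing permutations of each other coincide: the reversal compensates for a -> n - a,
   and 0 comes last by nonnegativity. *)
have -> : s' = rcons (rev [seq n%:R - a | a <- s0]) 0.
  apply: (sorted_eq ge_trans _ _ _ perm_s') => //.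
    by move=> x y; rewrite /= andbC => /le_anti.
  rewrite sorted_rcons_trans //; apply/andP; split.
    apply/allP => a a_s0; apply: (allP s'_ge0).
    by rewrite (perm_mem perm_s') mem_rcons inE a_s0 orbT.
  rewrite rev_sorted sorted_map.
  move: s_sorted; rewrite s_rcons sorted_rcons_trans // => /andP[_].
  by apply: sub_sorted => x y /=; rewrite lerD2l lerN2.
have n2 : (0 < n.-1)%N by rewrite -ltnS prednK.
(* Counting from 0, [lambda n.-1] is at position n - 2, just before the final 0; the reversal sends
   it to the head of [s0], the largest eigenvalue of G. *)
rewrite nth_rcons size_rev size_map sz0 ltn_predL n2.
rewrite nth_rev size_map sz0 ?ltn_predL //.
by rewrite prednK // subnn (nth_map 0) ?sz0 // s_rcons nth_rcons sz0 n2.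
Qed.

(** Pointwise, since [sgraph] records also carry proofs; [eq_adj_laplacian] transfers it to
    Laplacians. *)
Lemma compl_compl_adj G : adj (compl (compl G)) =2 adj G.
Proof.
move=> i j; rewrite /= /compl_adj /= /compl_adj.
by have [->|_] := eqVneq i j; rewrite ?adj_irr //= negbK.
Qed.

Lemma eq_adj_laplacian G H : adj G =2 adj H -> laplacian R G = laplacian R H.
Proof.
move=> GH; apply/matrixP => i j; rewrite !laplacianE GH.
by congr (_%:R *+ _ - _); apply: eq_card => k; rewrite !inE GH.
Qed.

Lemma nb_edges_compl G :
  (2 * nb_edges G + 2 * nb_edges (compl G) = n * n.-1)%N.
Proof.
rewrite -!handshake -big_split /=; under eq_bigr do rewrite degree_compl.
by rewrite sum_nat_const card_ord.
Qed.

End Laplacian.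

(** * Graphs whose Laplacian satisfies L^2 = cL *)

Section ClusterGraph.
Variables (R : realType) (n d : nat) (T : eqType).

(** L = (d + 1) I - E, with E the 0/1 matrix of the relation f i = f j. Classes have d + 1 elements,
    so E^2 = (d + 1) E and E L = 0. *)
Lemma cluster_laplacian_sqr (G : sgraph n) (f : 'I_n -> T) :
  (forall i j, adj G i j = (i != j) && (f i == f j)) ->
  (forall i, degree G i = d) ->
  laplacian R G *m laplacian R G = (d%:R + 1) *: laplacian R G.
Proof.
move=> adjE degE; pose E : 'M[R]_n := \matrix_(i, j) (f i == f j)%:R.
have LE : laplacian R G = (d%:R + 1)%:M - E.
  apply/matrixP => i j; rewrite laplacianE degE adjE !mxE.
  have [->|ij] := eqVneq i j; first by rewrite eqxx !mulr1n subr0 addrK.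
  by rewrite !mulr0n.
have rowE i : \sum_j E i j = d%:R + 1.
  rewrite -(degE i) natr_degree (bigD1 i) //= [in RHS](bigD1 i) //=.
  rewrite adj_irr add0r !mxE eqxx addrC; congr (_ + _); apply: eq_bigr => j ji.
  by rewrite mxE adjE [i == j]eq_sym ji.
have EE : E *m E = (d%:R + 1) *: E.
  apply/matrixP => i j; rewrite !mxE -(rowE i) mulr_suml.
  apply: eq_bigr => k _; rewrite !mxE.
  by have [->|] := eqVneq (f i) (f k); rewrite ?mul0r.
rewrite {1}LE mulmxBl mul_scalar_mx -[RHS]subr0; congr (_ - _).
by rewrite LE mulmxBr EE mul_mx_scalar subrr.
Qed.

End ClusterGraph.

(** An eigenvalue a satisfies a^2 = c a, so it is 0 or c. *)
Lemma lambda1_le (R : realType) n (G : sgraph n) (c : R) :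
  (0 < n)%N -> 0 <= c ->
  laplacian R G *m laplacian R G = c *: laplacian R G -> lambda R 1 G <= c.
Proof.
move=> n0 c0 LL; have /eigenvalueP[v vL v0] := eigenvalue_lambda1 R G n0.
have /eqP : v *m (laplacian R G *m laplacian R G) = v *m (c *: laplacian R G).
  by rewrite LL.
rewrite mulmxA -scalemxAr !vL -scalemxAl vL !scalerA -subr_eq0 -scalerBl.
rewrite scaler_eq0 (negbTE v0) orbF -mulrBl mulf_eq0 subr_eq0.
by case/orP => /eqP ->.
Qed.

(** * Circulant Laplacians and complements *)

Section CirculantGraphs.
Variables (R : realType) (n : nat).
Implicit Types G : sgraph n.

(** As p divides n, residues mod p depend only on indices mod n. *)
Lemma eqn_mod_shift p (i j i' j' k : nat) : (p %| n)%N ->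
  i' = i + k %[mod n] -> j' = j + k %[mod n] ->
  (i == j %[mod p]) = (i' == j' %[mod p]).
Proof.
move=> pn ii' jj'; rewrite -(modn_dvdm i' pn) ii' -(modn_dvdm j' pn) jj'.
by rewrite !modn_dvdm // eqn_modDr.
Qed.

Lemma eq_ord_shift (i j i' j' : 'I_n) k :
  i' = i + k %[mod n] -> j' = j + k %[mod n] -> (i == j) = (i' == j').
Proof.
move=> ii' jj'; have := eqn_mod_shift (dvdnn n) ii' jj'.
by rewrite !modn_small.
Qed.

Lemma circulant_compl G :
  circulant_mx (laplacian R G) -> circulant_mx (laplacian R (compl G)).
Proof.
move=> circG i j i' j' k ii' jj'; rewrite !laplacian_compl.
have := circG _ _ _ _ _ ii' jj'; move: (laplacian R G) => L Lij.
by rewrite !mxE Lij (eq_ord_shift ii' jj').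
Qed.

Lemma relabel_compl (s : 'S_n) G :
  adj (relabel s (compl G)) =2 adj (compl (relabel s G)).
Proof.
by move=> i j; rewrite /= /relabel_adj /= /compl_adj (inj_eq perm_inj).
Qed.

Lemma circulant_graph_compl G :
  circulant_graph R G -> circulant_graph R (compl G).
Proof.
case=> s circG; exists s; rewrite /circulant_ordering.
by rewrite (eq_adj_laplacian R (relabel_compl s G)); apply: circulant_compl.
Qed.

End CirculantGraphs.

(** * The extremal graph, given by congruence modulo p *)

Section ResidueGraph.
Variables n p : nat.

Definition residue_adj : rel 'I_n := fun i j => (i != j) && (i == j %[mod p]).

Lemma residue_adj_sym : symmetric residue_adj.
Proof. by move=> i j; rewrite /residue_adj eq_sym [(i %% p == _)%N]eq_sym. Qed.

Lemma residue_adj_irr : irreflexive residue_adj.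
Proof. by move=> i; rewrite /residue_adj eqxx. Qed.

Definition residue_graph : sgraph n := SGraph residue_adj_sym residue_adj_irr.

(** The class of i consists of the numbers k p + (i mod p) with k < q. *)
Lemma card_residue q (i : 'I_n) : n = (q * p)%N ->
  #|[set j : 'I_n | i == j %[mod p]]| = q.
Proof.
move=> nE; have p0 : (0 < p)%N.
  have: (0 < n)%N := leq_ltn_trans (leq0n i) (ltn_ord i).
  by rewrite nE muln_gt0 => /andP[].
have lt_n (k : 'I_q) : (k * p + i %% p < n)%N.
  rewrite {2}nE (@leq_trans (k.+1 * p)) ?leq_mul2r ?ltn_ord ?orbT //.
  by rewrite mulSn addnC ltn_add2r ltn_mod.
have -> : [set j : 'I_n | i == j %[mod p]] = [set Ordinal (lt_n k) | k : 'I_q].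
  apply/setP => j; rewrite inE; apply/eqP/imsetP => [ij|[k _ ->]]; last first.
    by rewrite /= modnMDl modn_mod.
  have jq : (j %/ p < q)%N by rewrite ltn_divLR // -nE.
  by exists (Ordinal jq) => //; apply: val_inj; rewrite /= ij -divn_eq.
rewrite card_imset ?card_ord // => k l /(congr1 val)/= /addIn/eqP.
by rewrite eqn_pmul2r // => /eqP/val_inj.
Qed.

Lemma degree_residue_graph q i : n = (q * p)%N ->
  degree residue_graph i = q.-1.
Proof.
move=> nE; rewrite -(card_residue i nE) [in RHS](cardsD1 i) inE eqxx /=.
by apply: eq_card => j; rewrite !inE /= /residue_adj eq_sym.
Qed.

End ResidueGraph.

Lemma residue_graph_circulant (R : realType) n p q : n = (q * p)%N ->
  circulant_ordering R (residue_graph n p) 1%g.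
Proof.
move=> nE i j i' j' k ii' jj'; rewrite !laplacianE /=.
have pn : (p %| n)%N by rewrite nE dvdn_mull.
have degE l : degree (relabel 1%g (residue_graph n p)) l = q.-1.
  rewrite -(degree_residue_graph l nE); apply: eq_card => m.
  by rewrite !inE /= /relabel_adj !perm1.
rewrite !degE /relabel_adj !perm1 /= /residue_adj (eq_ord_shift ii' jj').
by rewrite (eqn_mod_shift pn ii' jj').
Qed.

(** * The discrete Fourier transform on Z/n *)

Section FourierTransform.
Variables (R : realType) (n' : nat).
(** A successor size makes ['I_n] the additive group Z/n, where time reversal is j -> -j. *)
Let n := n'.+1.
Implicit Types (j k : 'I_n) (x : 'rV[R]_n).

Lemma expiD (a b : R) : expi (a + b) = expi a * expi b.
Proof.
by apply/eqP; rewrite /expi cosD sinD eq_complex /= eqxx addrC eqxx.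
Qed.

Lemma expiX (a : R) m : expi (a *+ m) = expi a ^+ m.
Proof.
elim: m => [|m IH]; first by rewrite mulr0n expr0 /expi cos0 sin0.
by rewrite mulrS exprS expiD IH.
Qed.

Lemma expi_conj (a : R) : Num.conj (expi a) = (expi a)^-1.
Proof.
have e1 : expi a * expi (- a) = 1 by rewrite -expiD subrr /expi cos0 sin0.
have e0 : expi a != 0.
  by apply: contra_eq_neq e1 => ->; rewrite mul0r eq_sym oner_eq0.
apply: (mulfI e0); rewrite divff // -e1; congr (_ * _).
by rewrite /expi cosN sinN.
Qed.

(** A character of Z/n; [dft_root j ^+ k] is the kernel of the transform. *)
Definition dft_root j : R[i] := expi (- (2 * pi / n%:R)) ^+ j.

Lemma expi_root_unity : expi (- (2 * pi / n%:R)) ^+ n = 1 :> R[i].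
Proof.
rewrite -expiX mulNrn -[_ *+ n]mulr_natr divfK ?pnatr_eq0 //.
by rewrite /expi cosN sinN mulr_natl cos2pi sin2pi oppr0.
Qed.

Lemma dft_rootD i j : dft_root (i + j) = dft_root i * dft_root j.
Proof. by rewrite /dft_root -exprD -[RHS](expr_mod _ expi_root_unity). Qed.

Lemma dft_root0 : dft_root 0 = 1.
Proof. by rewrite /dft_root expr0. Qed.

Lemma dft_rootN j : dft_root (- j) = Num.conj (dft_root j).
Proof.
rewrite {2}/dft_root -expiX expi_conj expiX -/(dft_root j).
have e1 : dft_root j * dft_root (- j) = 1 by rewrite -dft_rootD subrr dft_root0.
have e0 : dft_root j != 0.
  by apply: contra_eq_neq e1 => ->; rewrite mul0r eq_sym oner_eq0.
by apply: (mulfI e0); rewrite divff.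
Qed.

Lemma dft_rootXn j : dft_root j ^+ n = 1.
Proof. by rewrite /dft_root exprAC expi_root_unity expr1n. Qed.

(** cos(2a) = 1 - 2 sin(a)^2 with a = pi j / n, and sin a > 0 since 0 < a < pi for nonzero j. *)
Lemma dft_root_eq1 j : (dft_root j == 1) = (j == 0).
Proof.
apply/idP/idP => [|/eqP->]; last by rewrite dft_root0.
rewrite /dft_root -expiX mulNrn eq_complex /= cosN => /andP[cos1 _].
apply: contraTT cos1 => j0.
have jn0 : 0 < (j : nat)%:R :> R by rewrite ltr0n lt0n.
pose a : R := pi * j%:R / n%:R.
have -> : 2 * pi / n%:R *+ j = a *+ 2 :> R.
  by rewrite /a -mulr_natr -[RHS]mulr_natr; field; rewrite pnatr_eq0.
have sin_a : 0 < sin a.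
  apply: sin_gt0_pi; rewrite /a divr_gt0 ?ltr0n ?mulr_gt0 ?pi_gt0 //=.
  by rewrite ltr_pdivrMr ?ltr0n // ltr_pM2l ?pi_gt0 // ltr_nat.
rewrite cos_mulr2n cos2sin2.
apply/negP => /eqP h; have : sin a ^+ 2 = 0 by lra.
by move/eqP; rewrite sqrf_eq0 gt_eqF.
Qed.

Lemma sum_dft_rootX j : \sum_(k < n) dft_root j ^+ k = n%:R *+ (j == 0).
Proof.
have [->|j0] := eqVneq j 0.
  under eq_bigr do rewrite dft_root0 expr1n.
  by rewrite sumr_const card_ord.
have := subrX1 (dft_root j) n; rewrite dft_rootXn subrr => /esym/eqP.
by rewrite mulf_eq0 subr_eq0 dft_root_eq1 (negbTE j0) /= => /eqP.
Qed.

Lemma dftE x k : dft x 0 k = \sum_j (x 0 j)%:C * dft_root j ^+ k.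
Proof.
rewrite mxE; apply: eq_bigr => j _; congr (_ * _).
rewrite /dft_root -exprM -expiX; congr expi.
by rewrite mulNrn -[_ *+ (j * k)]mulr_natr natrM; field; rewrite pnatr_eq0.
Qed.

Lemma sum_dft x : \sum_k dft x 0 k = n%:R * (x 0 0)%:C.
Proof.
under eq_bigr do rewrite dftE.
rewrite exchange_big /=.
under eq_bigr do rewrite -mulr_sumr sum_dft_rootX.
rewrite (bigD1 0) // eqxx mulr1n mulrC big1 /= ?addr0 // => j /negbTE ->.
by rewrite mulr0n mulr0.
Qed.

(** Parseval without conjugates: summing over k keeps only the pairs with j = -i, and evenness makes
    their product a square. *)
Lemma sum_dft_sqr x : (forall j, x 0 (- j) = x 0 j) ->
  \sum_k dft x 0 k ^+ 2 = n%:R * (\sum_j x 0 j ^+ 2)%:C.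
Proof.
move=> x_even.
have -> : \sum_k dft x 0 k ^+ 2 =
    \sum_i \sum_j (x 0 i)%:C * (x 0 j)%:C * \sum_(k < n) dft_root (i + j) ^+ k.
  under eq_bigr do rewrite dftE expr2 mulr_suml.
  rewrite exchange_big /=; apply: eq_bigr => i _.
  under eq_bigr do rewrite mulr_sumr.
  rewrite exchange_big /=; apply: eq_bigr => j _.
  by rewrite mulr_sumr; apply: eq_bigr => k _; rewrite dft_rootD exprMn; ring.
rewrite rmorph_sum mulr_sumr; apply: eq_bigr => i _.
rewrite (bigD1 (- i)) //= [X in _ + X]big1 ?addr0 => [|j ji]; last first.
  by rewrite sum_dft_rootX addrC addr_eq0 (negbTE ji) mulr0n mulr0.
by rewrite sum_dft_rootX subrr eqxx mulr1n x_even rmorphXn expr2 mulrC.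
Qed.

Lemma normc_real (a : R) : ComplexField.Normc.normc a%:C = `|a|.
Proof. by rewrite /= expr0n addr0 sqrtr_sqr. Qed.

(** By evenness, reindexing by j -> -j shows that the transform equals its conjugate. *)
Lemma dft_even_real x k : (forall j, x 0 (- j) = x 0 j) ->
  dft x 0 k = (\sum_j x 0 j * complex.Re (dft_root j ^+ k))%:C.
Proof.
move=> x_even; have X_real : dft x 0 k \is Num.real.
  apply/CrealP; rewrite dftE rmorph_sum (reindex_inj oppr_inj) /=.
  apply: eq_bigr => j _; rewrite rmorphM rmorphXn x_even dft_rootN /= conjCK.
  by rewrite conj_Creal // complex_real.
rewrite -(RRe_real X_real); congr (_%:C); rewrite dftE raddf_sum /=.
apply: eq_bigr => j _; case: (dft_root j ^+ k) => a b /=.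
by rewrite mul0r subr0.
Qed.

Lemma Re_dft_rootX_le1 j k : complex.Re (dft_root j ^+ k) <= 1.
Proof. by rewrite /dft_root -exprM -expiX /= cos_le1. Qed.

(** * Lower bound on the DFT norm of feasible vectors *)

Section Feasible.
Variables (d : nat) (y : 'rV[R]_n).
Hypothesis y_feasible : dft_feasible d y.

Lemma xbar_even j : xbar d y 0 (- j) = xbar d y 0 j.
Proof.
have [_ _ _ y_sym] := y_feasible.
have [->|j0] := eqVneq j 0; first by rewrite oppr0.
have j0' : (0 < j)%N by rewrite lt0n.
have NjE : (- j : 'I_n) = (n - j)%N :> nat.
  by rewrite /= modn_small // ltn_subrL j0'.
rewrite !mxE NjE subn_eq0 leqNgt ltn_ord /= (gtn_eqF j0').
by apply: y_sym; rewrite NjE subnK // ltnW.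
Qed.

Lemma sum_feasible : \sum_j y 0 j = d%:R.
Proof.
have [y01 _ <- _] := y_feasible; apply: eq_bigr => j _.
by case: (y01 j) => ->; rewrite ?normr0 ?normr1.
Qed.

Lemma xbarE j : xbar d y 0 j = y 0 j - d%:R *+ (j == 0).
Proof.
have [_ y0 _ _] := y_feasible; rewrite mxE.
have [->|] := eqVneq j 0; first by rewrite /= y0 // sub0r mulr1n.
by rewrite -val_eqE /= => /negbTE ->; rewrite subr0.
Qed.

Lemma feasible_ge0 j : 0 <= y 0 j.
Proof. by have [y01 _ _ _] := y_feasible; case: (y01 j) => ->. Qed.

(** Real parts of roots of unity are at most 1 and the y_j are nonnegative with sum d, so the entry
    is at most -d + d = 0. *)
Lemma dft_xbar_normc k :
  dft (xbar d y) 0 k = - (ComplexField.Normc.normc (dft (xbar d y) 0 k))%:C.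
Proof.
rewrite (dft_even_real k xbar_even) normc_real ler0_norm ?rmorphN ?opprK //.
under eq_bigr do rewrite xbarE mulrBl.
rewrite big_split /= sumrN (bigD1 0 (F := fun j => _ *+ (j == 0) * _)) //=.
rewrite [X in _ - (_ + X)]big1 ?addr0 => [|j /negbTE ->]; last by rewrite mul0r.
rewrite mulr1n dft_root0 expr1n mulr1 subr_le0 -sum_feasible.
apply: ler_sum => j _.
by rewrite ler_piMr ?feasible_ge0 ?Re_dft_rootX_le1.
Qed.

Lemma sum_xbar_sqr : \sum_j xbar d y 0 j ^+ 2 = d%:R * (d%:R + 1).
Proof.
have [y01 y0 _ _] := y_feasible.
rewrite mulrDr mulr1 -{3}sum_feasible (bigD1 0) //= [in RHS](bigD1 0) //=.
rewrite y0 // add0r xbarE y0 // eqxx mulr1n sub0r sqrrN expr2.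
congr (_ + _); apply: eq_bigr => j /negbTE j0.
by rewrite xbarE j0 subr0; case: (y01 j) => ->; rewrite ?expr0n ?expr1n.
Qed.

(* Parseval gives sum_k |X_k|^2 = n d (d + 1), while sum_k |X_k| = n d because
   every X_k is a nonpositive real. *)
Lemma norm_infty_dft_ge : (0 < d)%N -> d%:R + 1 <= norm_infty (dft (xbar d y)).
Proof.
move=> d0; set M := norm_infty _.
pose c k := ComplexField.Normc.normc (dft (xbar d y) 0 k).
have c_ge0 k : 0 <= c k.
  by rewrite /c; case: (dft _ _ _) => a b; exact: sqrtr_ge0.
have cM k : c k <= M by exact: le_bigmax.
have sum_c : \sum_k c k = n%:R * d%:R.
  apply: (@complexI R); apply: oppr_inj; rewrite rmorph_sum -sumrN /=.
  under eq_bigr do rewrite -dft_xbar_normc.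
  have [_ y0 _ _] := y_feasible.
  by rewrite sum_dft xbarE eqxx y0 // sub0r rmorphM rmorphN !rmorph_nat mulrN.
have sum_c2 : \sum_k c k ^+ 2 = n%:R * (d%:R * (d%:R + 1)).
  apply: (@complexI R); rewrite rmorph_sum rmorphM rmorph_nat -sum_xbar_sqr.
  rewrite -sum_dft_sqr; last exact: xbar_even.
  by apply: eq_bigr => k _; rewrite [in RHS]dft_xbar_normc sqrrN -rmorphXn.
have nd0 : 0 < n%:R * d%:R :> R by rewrite mulr_gt0 ?ltr0n.
suff : n%:R * d%:R * (d%:R + 1) <= n%:R * d%:R * M by rewrite ler_pM2l.
rewrite -mulrA -sum_c2 -sum_c mulr_suml; apply: ler_sum => k _.
by rewrite expr2 ler_wpM2l.
Qed.

End Feasible.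

(** The vector of the [dft_root j ^+ k] is an eigenvector of L for -X_k, where X = [dft x]; L^2 = cL
    then forces X_k to be 0 or -c. *)
Lemma norm_infty_dft_circulant (L : 'M[R]_n) (c : R) (x : 'rV[R]_n) : 0 <= c ->
  circulant_mx L -> L *m L = c *: L -> x = - row 0 L ->
  norm_infty (dft x) <= c.
Proof.
move=> c0 circL LL xE; apply: bigmax_le => // k _.
have shift i j : L i (i + j) = L 0 j.
  apply/esym/(circL _ _ _ _ i); first by rewrite /= add0n.
  by rewrite /= modn_mod addnC.
have eigen i : \sum_j (L i j)%:C * dft_root j ^+ k =
    - dft x 0 k * dft_root i ^+ k.
  rewrite dftE -sumrN mulr_suml (reindex_inj (addrI i)) /=.
  apply: eq_bigr => j _.
  by rewrite shift xE !mxE dft_rootD exprMn rmorphN /=; ring.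
have : dft x 0 k ^+ 2 = - c%:C * dft x 0 k.
  have <- : \sum_j ((L *m L) 0 j)%:C * dft_root j ^+ k = dft x 0 k ^+ 2.
    under eq_bigr do rewrite mxE rmorph_sum mulr_suml.
    rewrite exchange_big /=.
    under eq_bigr => i _.
      under eq_bigr do rewrite rmorphM -mulrA.
      rewrite -mulr_sumr eigen mulrCA.
    over.
    by rewrite -mulr_sumr eigen dft_root0 expr1n mulr1 mulrNN.
  rewrite LL; under eq_bigr do rewrite mxE rmorphM -mulrA.
  by rewrite -mulr_sumr eigen dft_root0 expr1n mulr1 mulrN mulNr.
rewrite mulNr expr2 => /eqP; rewrite -subr_eq0 opprK -mulrDl mulf_eq0.
case/orP => [|/eqP ->]; last by rewrite /= expr0n addr0 sqrtr0.
by rewrite addr_eq0 -rmorphN => /eqP ->; rewrite normc_real normrN ger0_norm.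
Qed.

End FourierTransform.

(** * Adjacency rows as DFT solutions, and the theorem *)

Lemma degree_relabel n (s : 'S_n) (G : sgraph n) i :
  degree (relabel s G) i = degree G (s i).
Proof.
rewrite /degree -[RHS](card_preimset _ (@perm_inj _ s)); apply: eq_card => j.
by rewrite !inE.
Qed.

Lemma row_adjmx_feasible (R : realType) n d (n_gt0 : (0 < n)%N)
    (H : sgraph n) :
  (forall i, degree H i = d) -> circulant_mx (laplacian R H) ->
  dft_feasible d (row (Ordinal n_gt0) (adjmx R H)).
Proof.
set i0 := Ordinal n_gt0 => degH circH.
split=> [j|j j0||i j ij].
- by rewrite !mxE; case: (adj H i0 j); [right|left].
- by rewrite !mxE (_ : j = i0) ?adj_irr //; apply: val_inj.
- rewrite -(degH i0) natr_degree; apply: eq_bigr => j _.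
  by rewrite !mxE ger0_norm // ler0n.
(* Indices below n that add up to n are nonzero, so the entries compared below are off the
   diagonal. *)
have lt0 (k l : 'I_n) : (k + l = n)%N -> i0 != k.
  by move=> kl; apply/eqP => k0; have := ltn_ord l; rewrite -{2}kl -k0 ltnn.
(* Shifting by j sends (0, i) to (j, n), that is (j, 0); symmetry of [adj] then gives time
   symmetry. *)
have := circH i0 i j i0 j erefl.
rewrite ij modnn mod0n => /(_ erefl); rewrite !laplacianE (negbTE (lt0 _ _ ij)).
rewrite addnC in ij; rewrite eq_sym (negbTE (lt0 _ _ ij)) !mulr0n !sub0r.
by move/oppr_inj; rewrite !mxE [adj H j _]adj_sym.
Qed.

(** By regularity, putting -d in entry 0 of the row gives minus the first row of L, so the norm is
    at most d + 1, a lower bound for all feasible vectors. *)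
Lemma row_adjmx_dft_solution (R : realType) n d (n_gt0 : (0 < n)%N)
    (H : sgraph n) :
  (0 < d)%N -> (forall i, degree H i = d) -> circulant_mx (laplacian R H) ->
  laplacian R H *m laplacian R H = (d%:R + 1) *: laplacian R H ->
  dft_solution d (row (Ordinal n_gt0) (adjmx R H)).
Proof.
case: n n_gt0 H => // n' n'_gt0 H d0 degH circH LL.
have feas := row_adjmx_feasible n'_gt0 degH circH.
split=> // y yF; apply: le_trans (norm_infty_dft_ge yF d0).
apply: (norm_infty_dft_circulant (L := laplacian R H)) => //.
  by rewrite addr_ge0.
apply/rowP => j; rewrite (xbarE feas) !mxE degH.
by rewrite -[0 == j]eq_sym (_ : Ordinal n'_gt0 = 0) ?opprB //; apply: val_inj.
Qed.

Theorem theorem5p1 (R : realType) (n m : nat) (n_gt0 : (0 < n)%N)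
    (m_gt0 : (0 < m)%N) (n_dvd_2m : (n %| 2 * m)%N)
    (dS_dvd_n : ((2 * m) %/ n + 1 %| n)%N) :
  exists G : sgraph n,
    [/\ nb_edges G = m,
        circulant_graph R G,
        LEGM R G,
        (forall s : 'S_n, circulant_ordering R G s ->
           dft_solution ((2 * m) %/ n)%N
             (row (Ordinal n_gt0) (adjmx R (relabel s G)))) &
        circulant_graph R (compl G) /\ ACM R (compl G)].
Proof.
set d := ((2 * m) %/ n)%N in dS_dvd_n *.
have nd : (n * d = 2 * m)%N by rewrite mulnC divnK.
have d_gt0 : (0 < d)%N.
  case: posnP nd => // ->; rewrite muln0 => /eqP.
  by rewrite eq_sym muln_eq0 (gtn_eqF m_gt0).
have n_gt1 : (1 < n)%N.
  by rewrite (leq_trans _ (dvdn_leq n_gt0 dS_dvd_n)) // addn1 ltnS.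
have nE : n = ((d + 1) * (n %/ (d + 1)))%N by rewrite mulnC divnK.
set p := (n %/ (d + 1))%N in nE; pose G := residue_graph n p.
have degG i : degree G i = d by rewrite (degree_residue_graph i nE) addn1.
have nbG : nb_edges G = m.
  have := handshake G; rewrite (eq_bigr (fun=> d)) ?sum_nat_const ?card_ord ?nd //.
  by move/eqP; rewrite eqn_pmul2l // => /eqP.
have degGs (s : 'S_n) i : degree (relabel s G) i = d.
  by rewrite degree_relabel.
(* Stated for every [s] because the DFT claim concerns each circulant ordering; the classes become
   those of [s i] mod p. *)
have LL (s : 'S_n) : laplacian R (relabel s G) *m laplacian R (relabel s G) =
    (d%:R + 1) *: laplacian R (relabel s G).
  apply: (@cluster_laplacian_sqr _ _ _ _ _ (fun i => (s i %% p)%N)) => [i j|i].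
    by rewrite /= /relabel_adj /= /residue_adj (inj_eq perm_inj).
  exact: degGs.
have circG : circulant_graph R G by exists 1%g; exact: residue_graph_circulant nE.
have G_le : lambda R 1 G <= d%:R + 1.
  apply: lambda1_le => //; first by rewrite addr_ge0.
  apply: (@cluster_laplacian_sqr _ _ _ _ _ (fun i : 'I_n => (i %% p)%N)) => //.
have G_min (H : sgraph n) : nb_edges H = m -> lambda R 1 G <= lambda R 1 H.
  by move=> nbH; rewrite (le_trans G_le) // lambda1_ge // nbH.
exists G; split=> //.
- by move=> H; rewrite nbG; exact: G_min.
- move=> s circ_s; apply: row_adjmx_dft_solution => //; exact: degGs.
split; first exact: circulant_graph_compl.
(* The edge numbers of a graph and its complement have a constant sum. *)
move=> H nbH; have nbHc : nb_edges (compl H) = m.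
  have := nb_edges_compl H; rewrite -(nb_edges_compl G) nbH addnC => /addIn/eqP.
  by rewrite eqn_pmul2l // nbG => /eqP.
rewrite (algebraic_connectivity_compl R G n_gt1).
(* As a double complement, H falls under the complement formula. *)
have -> : algebraic_connectivity R H =
    algebraic_connectivity R (compl (compl H)).
  rewrite /algebraic_connectivity /lambda.
  by rewrite (eq_adj_laplacian R (compl_compl_adj H)).
by rewrite algebraic_connectivity_compl // lerD2l lerN2 G_min.
Qed.
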